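(* (i) If $X=(X_1,\dots,X_n)$ is a $K^n$-valued $K$-Gaussian random variable, then $\{X_1,\dots,X_n\}$ is an orthogonal set in $\mathcal{L}^\infty(\mathbb{P})$ if and only if $X_1,\dots,X_n$ are independent. (ii) If $X_1,\dots,X_n$ are independent $K$-valued $K$-Gaussian random variables, then the random vector $(X_1,\dots,X_n)$ is $K$-Gaussian.
   Context: $K$ is a local field (locally compact, non-discrete, totally disconnected topological field) with its non-archimedean absolute value $|\cdot|$ ($|x|=0\iff x=0$, $|xy|=|x||y|$, $|x+y|\le|x|\vee|y|$). $K^n$ is the Banach space over $K$ with norm $|(x_1,\dots,x_n)|=|x_1|\vee\dots\vee|x_n|$. In a normed space $(E,\|\cdot\|)$ over $K$ (norm satisfying $\|x\|=0\iff x=0$, $\|\alpha x\|=|\alpha|\|x\|$, $\|x+y\|\le\|x\|\vee\|y\|$), a subset $F$ is orthogonal if $\|\sum_{i=1}^m\alpha_ix_i\|=\bigvee_{i=1}^m|\alpha_i|\|x_i\|$ for every finite $\{x_1,\dots,x_m\}\subset F$ and $\alpha_i\in K$; orthonormal if moreover each element has norm $1$. $\mathcal{L}^\infty(\mathbb{P})$ is the space of measurable $f:\Omega\to K$ with $\operatorname{ess\,sup}|f|<\infty$, modulo a.s. equality, normed by $\|f\|_\infty=\operatorname{ess\,sup}|f|$. For a separable Banach space $E$ over $K$, an $E$-valued random variable $X$ is $K$-Gaussian if whenever $X_1,X_2$ are independent copies of $X$ and $(\alpha_{11},\alpha_{12}),(\alpha_{21},\alpha_{22})$ is an orthonormal pair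 in $K^2$, $(\alpha_{11}X_1+\alpha_{12}X_2,\alpha_{21}X_1+\alpha_{22}X_2)$ has the same law as $(X_1,X_2)$. *)

(* Defs.v *)
From HB Require Import structures.
From mathcomp Require Import all_boot all_order all_algebra.
From mathcomp Require Import all_classical all_reals all_analysis.
From mathcomp Require Import ess_sup_inf.
Set Implicit Arguments. Unset Strict Implicit. Unset Printing Implicit Defensive.
Import Order.TTheory GRing.Theory Num.Theory.
Local Open Scope classical_set_scope.
Local Open Scope ring_scope.

Section LocalFieldDefs.
Variables (R : realType) (K : fieldType) (absv : K -> R).

Definition nonarch_absv : Prop :=
  [/\ forall x, 0 <= absv x,
      forall x, absv x = 0 <-> x = 0,
      forall x y, absv (x * y) = absv x * absv y &
      forall x y, absv (x + y) <= Num.max (absv x) (absv y)].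

End LocalFieldDefs.

Section MetricDefs.
Variables (R : realType) (T : Type) (dist : T -> T -> R).

Definition mopen (U : set T) : Prop :=
  forall x, U x -> exists2 r : R, 0 < r & forall y, dist x y < r -> U y.

Definition mcompact (A : set T) : Prop :=
  forall F : set (set T), (forall U, F U -> mopen U) ->
    A `<=` \bigcup_(U in F) U ->
    exists2 G : set (set T), finite_set G /\ G `<=` F & A `<=` \bigcup_(U in G) U.

Definition mborel : set (set T) := <<s mopen >>.

End MetricDefs.

(* K is a local field whose topology is the one induced by its
   non-archimedean absolute value absv: non-discrete (absv nontrivial)
   and locally compact (total disconnectedness is automatic). *)
Definition local_field_absv (R : realType) (K : fieldType) (absv : K -> R) : Prop :=
  [/\ nonarch_absv absv,
      exists x : K, 0 < absv x < 1 &
      forall x : K, exists2 r : R, 0 < r &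
        mcompact (fun a b => absv (a - b)) (fun y => absv (x - y) <= r)].

Definition maxnorm (R : realType) (K : fieldType) (absv : K -> R) (n : nat)
  (x : 'rV[K]_n) : R := \big[Num.max/0]_(i < n) absv (x ord0 i).

Section Probability.
Variables (R : realType) (K : fieldType) (V : lmodType K) (nrm : V -> R).

Definition distV (x y : V) : R := nrm (x - y).
Definition distV2 (x y : V * V) : R := Num.max (nrm (x.1 - y.1)) (nrm (x.2 - y.2)).

Definition is_rv d (T : measurableType d) (X : T -> V) : Prop :=
  forall B, mborel distV B -> measurable (X @^-1` B).

Definition same_law d (T : measurableType d) (P : probability T R) (X : T -> V)
  d' (T' : measurableType d') (P' : probability T' R) (X' : T' -> V) : Prop :=
  forall B, mborel distV B -> P (X @^-1` B) = P' (X' @^-1` B).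

Definition same_law2 d (T : measurableType d) (P : probability T R) (X : T -> V * V)
  d' (T' : measurableType d') (P' : probability T' R) (X' : T' -> V * V) : Prop :=
  forall B, mborel distV2 B -> P (X @^-1` B) = P' (X' @^-1` B).

Definition indep2 d (T : measurableType d) (P : probability T R) (X1 X2 : T -> V) : Prop :=
  forall A B, mborel distV A -> mborel distV B ->
    P (X1 @^-1` A `&` X2 @^-1` B) = (P (X1 @^-1` A) * P (X2 @^-1` B))%E.

End Probability.

Definition orthonormal_pair (R : realType) (K : fieldType) (absv : K -> R)
  (a11 a12 a21 a22 : K) : Prop :=
  [/\ Num.max (absv a11) (absv a12) = 1,
      Num.max (absv a21) (absv a22) = 1 &
      forall c1 c2 : K,
        Num.max (absv (c1 * a11 + c2 * a21)) (absv (c1 * a12 + c2 * a22))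
        = Num.max (absv c1) (absv c2)].

Definition KGaussian (R : realType) (K : fieldType) (absv : K -> R)
  (V : lmodType K) (nrm : V -> R) d (T : measurableType d) (P : probability T R)
  (X : T -> V) : Prop :=
  is_rv nrm X /\
  forall d' (T' : measurableType d') (P' : probability T' R) (X1 X2 : T' -> V),
    is_rv nrm X1 -> is_rv nrm X2 ->
    same_law nrm P' X1 P X -> same_law nrm P' X2 P X -> indep2 nrm P' X1 X2 ->
    forall a11 a12 a21 a22 : K, orthonormal_pair absv a11 a12 a21 a22 ->
      same_law2 nrm P' (fun w => (a11 *: X1 w + a12 *: X2 w, a21 *: X1 w + a22 *: X2 w))
                    P' (fun w => (X1 w, X2 w)).

Definition indep (R : realType) (K : fieldType) (absv : K -> R) d (T : measurableType d)
  (P : probability T R) (n : nat) (X : 'I_n -> T -> K) : Prop :=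
  forall B : 'I_n -> set K, (forall i, mborel (fun a b => absv (a - b)) (B i)) ->
    P (\bigcap_(i in [set: 'I_n]) (X i @^-1` B i)) = (\prod_(i < n) P (X i @^-1` B i))%E.

Definition Linf_norm (R : realType) (K : fieldType) (absv : K -> R) d (T : measurableType d)
  (P : probability T R) (f : T -> K) : \bar R := ess_sup P (fun w => (absv (f w))%:E).

Definition Linf_orthogonal (R : realType) (K : fieldType) (absv : K -> R) d
  (T : measurableType d) (P : probability T R) (n : nat) (X : 'I_n -> T -> K) : Prop :=
  (forall i, (forall B, mborel (fun a b => absv (a - b)) B -> measurable (X i @^-1` B))
             /\ (Linf_norm absv P (X i) < +oo)%E) /\
  forall (S : {set 'I_n}) (alpha : 'I_n -> K),
    Linf_norm absv P (fun w => \sum_(i in S) alpha i * X i w)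
    = \big[Order.max/0%E]_(i in S) ((absv (alpha i))%:E * Linf_norm absv P (X i))%E.

(* Main.v *)
(* The law of a Gaussian X is described by the ball probabilities
   f_s(u) = P(|X - u| <= s), since in a separable ultrametric space the balls
   form a pi-system generating the Borel sets.  An orthonormal pair acts on V^2
   as a linear isometry and so permutes the balls of V^2; hence X is Gaussian
   iff f_s(u') f_s(v') = f_s(u) f_s(v) whenever (u', v') is the image of (u, v)
   under an orthonormal pair.  This gives (ii) coordinate by coordinate.

   The shear (1, a; 0, 1) shows that f_s(u + a v) = f_s(u) if |a| <= 1 and
   f_s(v) > 0, so {f_s > 0} is a module over the ring of integers on which f_s
   is constant, and X lies in it almost surely.  In particular every X_i is
   small with positive probability; for independent coordinates, making all but
   one term of a linear combination small gives the orthogonality.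

   Conversely, suppose that the X_i are orthogonal and |y| <= ||X_i||.  If y e_i
   were outside {f_s > 0}, a linear functional would separate it from this
   module, which contradicts orthogonality.  Hence the law of X is invariant
   under translation by y e_i, and as for Haar measure, Fubini shows that X_i is
   independent of the other coordinates. *)
Require Import Defs.
From HB Require Import structures.
From mathcomp Require Import all_boot all_order all_algebra.
From mathcomp Require Import all_classical all_reals all_analysis.
From mathcomp Require Import ess_sup_inf.
From mathcomp Require Import ring.
Import Order.TTheory GRing.Theory Num.Theory.
Local Open Scope classical_set_scope.
Local Open Scope ring_scope.
Set Implicit Arguments. Unset Strict Implicit.

(** * Ultrametric spaces and their Borel sets *)

Section Ultrametric.
Variables (R : realType) (W : Type) (dist : W -> W -> R).

Definition ultrametric : Prop :=
  [/\ forall x, dist x x = 0,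
      forall x y, dist x y = dist y x &
      forall x y z, dist x z <= Num.max (dist x y) (dist y z)].

Definition cball (x : W) (s : R) : set W := [set y | dist x y <= s].

(** Separability, stated with sequences so that open sets become countable unions of balls. *)
Definition countable_nets : Prop :=
  forall s : R, 0 < s -> exists e : nat -> W, forall x, exists k, dist (e k) x <= s.

Lemma mopen_mborel A : mopen dist A -> mborel dist A.
Proof. by move=> oA; apply: sub_sigma_algebra. Qed.

Hypothesis dist_ultra : ultrametric.

Lemma cball_center x s : 0 <= s -> cball x s x.
Proof. by case: dist_ultra => d0 _ _ s0; rewrite /cball /= d0. Qed.

Lemma cball_eq x y s : dist x y <= s -> cball x s = cball y s.
Proof.
case: dist_ultra => _ dC dU xy; apply/seteqP; split => z /= Hz.
  by apply: le_trans (dU _ x _) _; rewrite ge_max dC xy.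
by apply: le_trans (dU _ y _) _; rewrite ge_max xy.
Qed.

Lemma cball_mopen x s : 0 < s -> mopen dist (cball x s).
Proof.
move=> s0 y xy; exists s => // z yz.
by rewrite (cball_eq xy); apply: ltW.
Qed.

Lemma cball_mborel x s : 0 < s -> mborel dist (cball x s).
Proof. by move=> s0; apply: mopen_mborel; exact: cball_mopen. Qed.

Let balls : set (set W) :=
  [set A | A = set0 \/ exists x s, 0 < s /\ A = cball x s].

(** Two balls with a common point can both be centred there, so the smaller radius decides. Disjoint
    balls are the reason for having the empty set in [balls]. *)
Lemma balls_setI : setI_closed balls.
Proof.
move=> A B [->|[x [s [s0 ->]]]]; first by rewrite set0I; left.
move=> [->|[y [t [t0 ->]]]]; first by rewrite setI0; left.
have [->|/set0P[z [xz yz]]] := eqVneq (cball x s `&` cball y t) set0; first by left.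
right; exists z, (Num.min s t); split; first by rewrite lt_min s0.
by rewrite (cball_eq xz) (cball_eq yz); apply/seteqP; split => w; rewrite /cball /= le_min => /andP.
Qed.

Hypothesis dist_nets : countable_nets.

(** A net ball that contains a point of an open [U] is also centred at that point, hence lies in [U]
    once its radius is small. So [U] is the union of the countably many net balls of radii
    [n.+1%:R^-1] inside it. *)
Lemma mborel_sub_balls : mborel dist `<=` <<s balls >>.
Proof.
have inv0 n : 0 < (n.+1%:R^-1 : R) by [].
have [e He] := choice (fun n => dist_nets (inv0 n)).
apply: smallest_sub; first exact: smallest_sigma_algebra.
move=> U oU.
pose F n k := if `[< cball (e n k) n.+1%:R^-1 `<=` U >]
  then cball (e n k) n.+1%:R^-1 else set0.
have -> : U = \bigcup_n \bigcup_k F n k.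
  apply/seteqP; split => [x Ux|x [n _ [k _]]]; rewrite /F; last first.
    by case: asboolP => // H /H.
  have [r r0 rU] := oU _ Ux.
  have [n nr] : exists n : nat, (n.+1%:R^-1 : R) < r.
    have [m] := @ltr_add_invr R 0 r r0.
    by rewrite add0r; exists m.
  have [k xk] := He n x.
  exists n => //; exists k => //; case: asboolP => // -[].
  rewrite (cball_eq xk) => y xy; apply: rU.
  exact: le_lt_trans xy nr.
have [_ _ bU] := smallest_sigma_algebra setT balls.
apply: (bU) => n; apply: (bU) => k.
apply: sub_sigma_algebra; rewrite /F; case: asboolP => _; last by left.
by right; exists (e n k), n.+1%:R^-1.
Qed.

Lemma mborel_dynkin (C : set (set W)) : dynkin C ->
  (forall x s, 0 < s -> C (cball x s)) -> mborel dist `<=` C.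
Proof.
move=> dC bC A /mborel_sub_balls; move: A.
apply: (lambda_system_subset balls_setI) => //; first exact/dynkin_lambda_system.
move=> A [->|[x [s [s0 ->]]]]; last exact: bC.
by case: dC => CT CC _; rewrite -setCT; exact: CC.
Qed.

Lemma measurable_preimage_balls d (T : measurableType d) (f : T -> W) :
  (forall x s, 0 < s -> measurable (f @^-1` cball x s)) ->
  forall B, mborel dist B -> measurable (f @^-1` B).
Proof.
move=> fb; apply: (mborel_dynkin (C := [set B | measurable (f @^-1` B)])) => //.
split=> [|A mA|F _ mF] /=; first by rewrite preimage_setT.
  by rewrite -preimage_setC; exact: measurableC.
by rewrite preimage_bigcup; exact: bigcupT_measurable.
Qed.

Lemma probability_eq_balls d (T : measurableType d) (P : probability T R)
    d' (T' : measurableType d') (P' : probability T' R)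
    (f : T -> W) (g : T' -> W) :
  (forall B, mborel dist B -> measurable (f @^-1` B)) ->
  (forall B, mborel dist B -> measurable (g @^-1` B)) ->
  (forall x s, 0 < s -> P (f @^-1` cball x s) = P' (g @^-1` cball x s)) ->
  forall B, mborel dist B -> P (f @^-1` B) = P' (g @^-1` B).
Proof.
move=> mf mg fg B mB.
(* The Dynkin class includes the measurability of both preimages, which the formulas for complements
   and disjoint unions require. *)
suff : [/\ measurable (f @^-1` B), measurable (g @^-1` B) &
           P (f @^-1` B) = P' (g @^-1` B)] by case.
move: B mB; apply: (mborel_dynkin (C := [set B | [/\ measurable (f @^-1` B),
   measurable (g @^-1` B) & P (f @^-1` B) = P' (g @^-1` B)]])); last first.
  by move=> x s s0; split; [apply: mf|apply: mg|exact: fg]; exact: cball_mborel.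
split=> [|A [mfA mgA PA]|F tF mF] /=.
- by rewrite !preimage_setT !probability_setT.
- rewrite -!preimage_setC; split; [exact: measurableC|exact: measurableC|].
  by rewrite !probability_setC// PA.
- rewrite !preimage_bigcup.
  have mfF n : measurable (f @^-1` F n) by case: (mF n).
  have mgF n : measurable (g @^-1` F n) by case: (mF n).
  split; [exact: bigcupT_measurable|exact: bigcupT_measurable|].
  have tpre U (h : U -> W) : trivIset setT (fun n => h @^-1` F n).
    move=> i j _ _ [x [Fi Fj]]; apply: tF => //; by exists (h x).
  rewrite !measure_bigcup//; apply: eq_eseriesr => n _.
  by case: (mF n).
Qed.

End Ultrametric.

Lemma mborel_preimage_lip (R : realType) (W W' : Type) (dist : W -> W -> R)
    (dist' : W' -> W' -> R) (f : W -> W') :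
  (forall x y, dist' (f x) (f y) <= dist x y) ->
  forall B, mborel dist' B -> mborel dist (f @^-1` B).
Proof.
move=> lf; apply: smallest_sub.
  have [s0 sC sU] := smallest_sigma_algebra setT (mopen dist).
  split => [|A mA|F mF] /=; first by rewrite preimage_set0.
    by rewrite setTD -preimage_setC -setTD; exact: sC.
  by rewrite preimage_bigcup; exact: sU.
move=> U oU; apply: sub_sigma_algebra => x /oU[r r0 rU].
by exists r => // y xy; apply: rU; exact: le_lt_trans (lf _ _) xy.
Qed.

(** * Local fields *)

Section NonarchAbsv.
Variables (R : realType) (K : fieldType) (absv : K -> R).
Hypothesis habs : nonarch_absv absv.

Lemma absv_ge0 x : 0 <= absv x. Proof. by case: habs. Qed.

Lemma absv0 : absv 0 = 0. Proof. by case: habs => _ H _ _; exact/H. Qed.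

Lemma absv_gt0 x : (0 < absv x) = (x != 0).
Proof.
case: habs => _ H _ _; rewrite lt_neqAle absv_ge0 andbT eq_sym; congr (~~ _).
by apply/eqP/eqP => /H.
Qed.

Lemma absvM x y : absv (x * y) = absv x * absv y. Proof. by case: habs. Qed.

Lemma absvD x y : absv (x + y) <= Num.max (absv x) (absv y).
Proof. by case: habs. Qed.

Lemma absv1 : absv 1 = 1.
Proof.
have := absvM 1 1; rewrite mulr1 => /esym/eqP.
rewrite -subr_eq0 -{3}[absv 1]mulr1 -mulrBr mulf_eq0 subr_eq0.
by rewrite (negPf (lt0r_neq0 _)) ?absv_gt0 ?oner_eq0//= => /eqP.
Qed.

Lemma absvN x : absv (- x) = absv x.
Proof.
rewrite -mulN1r absvM; suff -> : absv (-1) = 1 by rewrite mul1r.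
apply/eqP; rewrite -(@pexpr_eq1 _ _ 2) ?absv_ge0//.
by rewrite expr2 -absvM mulrNN mulr1 absv1.
Qed.

Lemma absvV x : absv x^-1 = (absv x)^-1.
Proof.
have [->|x0] := eqVneq x 0; first by rewrite invr0 absv0 invr0.
apply: (mulIf (lt0r_neq0 (_ : 0 < absv x))); first by rewrite absv_gt0.
by rewrite -absvM !mulVf ?absv1// gt_eqF// absv_gt0.
Qed.

Lemma absvX x k : absv (x ^+ k) = absv x ^+ k.
Proof. by elim: k => [|k IH]; rewrite ?absv1// !exprS absvM IH. Qed.

Lemma absv_sum_le (I : finType) (P : pred I) (F : I -> K) (s : R) :
  0 <= s -> (forall i, P i -> absv (F i) <= s) -> absv (\sum_(i | P i) F i) <= s.
Proof.
move=> s0 Fs; elim/big_ind: _ => //; first by rewrite absv0.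
by move=> x y xs ys; apply: le_trans (absvD x y) _; rewrite ge_max xs.
Qed.

Lemma absv_prod (I : Type) (r : seq I) (F : I -> K) :
  absv (\prod_(i <- r) F i) = \prod_(i <- r) absv (F i).
Proof. by apply: (big_morph absv absvM absv1). Qed.

(** Otherwise [x = (x + y) - y] would have absolute value at most [s]. *)
Lemma absvD_gt x y s : absv y <= s -> s < absv x -> s < absv (x + y).
Proof.
move=> ys sx; rewrite ltNge; apply/negP => xys.
move: sx; rewrite ltNge => /negP; apply.
rewrite -(addrK y x); apply: le_trans (absvD _ _) _.
by rewrite absvN ge_max xys.
Qed.

Definition nonarch_norm (V : lmodType K) (nrm : V -> R) : Prop :=
  [/\ forall x, 0 <= nrm x,
      forall a x, nrm (a *: x) = absv a * nrm x &
      forall x y, nrm (x + y) <= Num.max (nrm x) (nrm y)].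

Section Norm.
Variables (V : lmodType K) (nrm : V -> R).
Hypothesis hn : nonarch_norm nrm.

Lemma nonarch_norm0 : nrm 0 = 0.
Proof. by case: hn => _ H _; rewrite -(scale0r 0) H absv0 mul0r. Qed.

Lemma nonarch_normN x : nrm (- x) = nrm x.
Proof. by case: hn => _ H _; rewrite -scaleN1r H absvN absv1 mul1r. Qed.

Lemma nonarch_norm_le x y s : nrm x <= s -> nrm y <= s -> nrm (x + y) <= s.
Proof.
by case: hn => _ _ H xs ys; apply: le_trans (H x y) _; rewrite ge_max xs.
Qed.

Lemma nonarch_normZ_le a x s : absv a <= 1 -> nrm x <= s -> nrm (a *: x) <= s.
Proof.
case: hn => n0 H _ a1 xs; rewrite H; apply: le_trans xs.
by rewrite ler_piMl.
Qed.

Lemma distV_ultrametric : ultrametric (distV nrm).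
Proof.
case: (hn) => _ _ nD; rewrite /distV; split => [x|x y|x y z].
- by rewrite subrr nonarch_norm0.
- by rewrite -nonarch_normN opprB.
- by apply: le_trans (nD _ _); rewrite addrA subrK.
Qed.

Lemma distV2_ultrametric : ultrametric (distV2 nrm).
Proof.
have [d0 dC dD] := distV_ultrametric; rewrite /distV2.
split => [x|x y|x y z].
- by rewrite [nrm _]d0 [nrm _]d0 maxxx.
- by rewrite [nrm _]dC [nrm (x.2 - _)]dC.
- rewrite ge_max; apply/andP; split.
    by apply: le_trans (dD _ y.1 _) _; rewrite ge_max !le_max !lexx ?orbT.
  by apply: le_trans (dD _ y.2 _) _; rewrite ge_max !le_max !lexx ?orbT.
Qed.

Lemma distV2_nets : countable_nets (distV nrm) -> countable_nets (distV2 nrm).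
Proof.
move=> h s s0; have [e He] := h _ s0.
pose dec k := odflt (0, 0)%N (unpickle k : option (nat * nat)).
exists (fun k => (e (dec k).1, e (dec k).2)) => -[x y].
have [[i xi] [j yj]] := (He x, He y).
exists (pickle (i, j)); rewrite /dec pickleK /= /distV2 /= ge_max.
by apply/andP; split.
Qed.

Lemma cball_distV2 u v s :
  cball (distV2 nrm) (u, v) s = cball (distV nrm) u s `*` cball (distV nrm) v s.
Proof.
by apply/seteqP; split => -[x y]; rewrite /cball /distV2 /= ge_max => /andP.
Qed.

End Norm.

Lemma nonarch_norm_absv : @nonarch_norm K^o absv.
Proof. by split; [exact: absv_ge0|exact: absvM|exact: absvD]. Qed.

Section MaxNorm.
Variable n : nat.

Lemma maxnorm_leP (x : 'rV[K]_n) s : 0 <= s ->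
  maxnorm absv x <= s <-> forall i, absv (x ord0 i) <= s.
Proof.
move=> s0; split=> [/bigmax_leP[_ H] i|H]; first exact: H.
by apply/bigmax_leP.
Qed.

Lemma maxnorm_ge0 (x : 'rV[K]_n) : 0 <= maxnorm absv x.
Proof. by rewrite /maxnorm; elim/big_rec: _ => // i y _ y0; rewrite le_max y0 orbT. Qed.

Lemma absv_coord_le (x : 'rV[K]_n) i : absv (x ord0 i) <= maxnorm absv x.
Proof. by apply (maxnorm_leP x (maxnorm_ge0 x)). Qed.

Lemma nonarch_norm_maxnorm : nonarch_norm (maxnorm absv (n := n)).
Proof.
split => [|a x|x y]; first exact: maxnorm_ge0.
  apply/eqP; rewrite eq_le; apply/andP; split.
    apply/maxnorm_leP; first by rewrite mulr_ge0 ?absv_ge0 ?maxnorm_ge0.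
    by move=> i; rewrite mxE absvM ler_wpM2l ?absv_ge0// absv_coord_le.
  have [->|a0] := eqVneq a 0; first by rewrite absv0 mul0r maxnorm_ge0.
  rewrite mulrC -ler_pdivlMr ?absv_gt0//.
  apply/maxnorm_leP; first by rewrite mulr_ge0 ?invr_ge0 ?absv_ge0 ?maxnorm_ge0.
  move=> i; rewrite ler_pdivlMr ?absv_gt0// mulrC -absvM.
  by apply: le_trans (absv_coord_le _ i); rewrite mxE.
apply/maxnorm_leP; first by rewrite le_max maxnorm_ge0.
move=> i; rewrite mxE; apply: le_trans (absvD _ _) _.
by rewrite ge_max !le_max !absv_coord_le ?orbT.
Qed.

Lemma maxnorm_nets : countable_nets (fun a b => absv (a - b)) ->
  countable_nets (distV (maxnorm absv (n := n))).
Proof.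
move=> h s s0; have [e He] := h _ s0.
(* A row of net indices is coded as a finite function, an element of a countable type; the default
   stands for numbers that code nothing. *)
pose dec k := odflt [ffun=> 0%N] (unpickle k : option {ffun 'I_n -> nat}).
exists (fun k => \row_i e (dec k i)) => x.
have [k Hk] := choice (fun i => He (x ord0 i)).
exists (pickle [ffun i => k i]); rewrite /dec pickleK /=.
rewrite /distV; apply/maxnorm_leP => [|i]; first exact: ltW.
by rewrite !mxE ffunE.
Qed.

End MaxNorm.
End NonarchAbsv.

Section LocalField.
Variables (R : realType) (K : fieldType) (absv : K -> R).
Hypothesis hK : local_field_absv absv.

Let habs : nonarch_absv absv. Proof. by case: hK. Qed.
Let distK := fun a b : K => absv (a - b).
Let ultraK : ultrametric distK := distV_ultrametric habs (nonarch_norm_absv habs).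

Lemma absv_small (e : R) : 0 < e -> exists2 t : K, 0 < absv t & absv t <= e.
Proof.
move=> e0; case: hK => _ [x /andP[x0 x1]] _.
have : (fun k => absv x ^+ k) @ \oo --> 0.
  by apply: cvg_expr; rewrite ger0_norm ?ltW.
move=> /cvgrPdist_le/(_ _ e0)[N _ /(_ N (leqnn N))] /=.
rewrite sub0r normrN ger0_norm ?(exprn_ge0 _ (ltW x0))// => xN.
by exists (x ^+ N); rewrite absvX// exprn_gt0.
Qed.

(** Local compactness makes the valuation discrete. The open sets [U c] with [0 < c < absv u] cover
    a compact ball about 0; by a finite subcover some [c < absv u] bounds all absolute values below
    [absv u], and division by [absv u] gives a bound below 1. *)
Lemma absv_gap : exists2 r : R, 0 < r < 1 & forall x : K, absv x < 1 -> absv x <= r.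
Proof.
case: hK => _ _ /(_ 0)[r0 r0_gt0 cB].
have [u u0 ur] := absv_small r0_gt0.
pose U (c : R) : set K := [set x | (absv u <= absv x) \/ (absv x <= c)].
have oU c : 0 < c -> mopen distK (U c).
  move=> c0 x Ux; exists (Num.min c (absv u)); first by rewrite lt_min c0.
  move=> y; rewrite lt_min => /andP[xy1 xy2]; case: Ux => [ux|xc].
    left; rewrite leNgt; apply/negP => yu; move: ux; rewrite leNgt => /negP; apply.
    rewrite -(subrK y x); apply: le_lt_trans (absvD habs _ _) _.
    by rewrite gt_max xy2.
  right; rewrite -(subrK x y); apply: le_trans (absvD habs _ _) _.
  by rewrite ge_max xc andbT -absvN// opprB ltW.
pose F : set (set K) := [set U c | c in [set c : R | 0 < c < absv u]].
case: (cB F) => [_ [c /andP[c0 _] <-]|x _|G [finG GF] cov]; first exact: oU.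
- have [ux|xu] := leP (absv u) (absv x).
    exists (U (absv u / 2)); last by left.
    by exists (absv u / 2) => //=; rewrite divr_gt0//= ltr_pdivrMr// ltr_pMr// ltr1n.
  exists (U (Num.max (absv x) (absv u / 2))); last by right; rewrite le_max lexx.
  exists (Num.max (absv x) (absv u / 2)) => //=.
  rewrite lt_max gt_max xu divr_gt0//= ?orbT//=.
  by rewrite ltr_pdivrMr// ltr_pMr// ltr1n.
- have /choice[sel Hsel] : forall V : set K,
      exists c : R, 0 < c < absv u /\ (F V -> V = U c).
    move=> V; have [[c Hc <-]|nF] := pselect (F V); first by exists c.
    exists (absv u / 2); split => //.
    by rewrite divr_gt0//= ltr_pdivrMr// ltr_pMr// ltr1n.
  have /finite_seqP[q Gq] := finG.
  (* Starting the maximum at [absv u / 2] keeps [c] strictly between 0 and [absv u], even for an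
     empty subcover. *)
  set c := \big[Num.max/(absv u / 2)]_(V <- q) sel V.
  have cu : c < absv u.
    apply: bigmax_lt => [|V _]; first by rewrite ltr_pdivrMr// ltr_pMr// ltr1n.
    by have [/andP[]] := Hsel V.
  have c0 : 0 < c.
    apply: (@lt_le_trans _ _ (absv u / 2)); first by rewrite divr_gt0.
    rewrite /c; elim/big_rec: _ => // V y _ Hy.
    by rewrite le_max Hy orbT.
  exists (c / absv u); first by rewrite divr_gt0//= ltr_pdivrMr// mul1r.
  move=> x x1; rewrite ler_pdivlMr// -absvM//.
  have xu : absv (x * u) < absv u by rewrite absvM// gtr_pMl.
  have [V GV] : (\bigcup_(V in G) V) (x * u).
    by apply: cov; rewrite sub0r absvN// (le_trans (ltW xu)).
  have [_ /(_ (GF _ GV)) VU] := Hsel V.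
  rewrite VU => -[|]; first by rewrite leNgt xu.
  move=> /le_trans; apply; apply: le_bigmax_seq => //.
  by move: GV; rewrite Gq.
Qed.

(** A compact ball about 0 has finite nets at every scale. Its images under division by [t ^+ m]
    exhaust [K], and a net at scale [s * absv t ^+ m] becomes one at scale [s]. *)
Lemma local_field_nets : countable_nets distK.
Proof.
case: (hK) => _ [t /andP[t0 t1]] /(_ 0)[r0 r0_gt0 cB] s s0.
have ball_net a : 0 < a ->
    exists e : nat -> K, forall x, absv x <= r0 -> exists k, absv (e k - x) <= a.
  move=> a0; pose F : set (set K) := [set cball distK c a | c in [set: K]].
  case: (cB F) => [_ [c _ <-]|x _|G [finG GF] cov].
  - exact: (cball_mopen ultraK).
  - by exists (cball distK x a); [exists x|apply: cball_center => //; exact: ltW].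
  have /choice[sel Hsel] : forall V : set K,
      exists c : K, F V -> V = cball distK c a.
    move=> V; have [[c Hc <-]|nF] := pselect (F V); first by exists c.
    by exists 0.
  have /finite_seqP[q Gq] := finG.
  exists (fun k => sel (nth set0 q k)) => x xr.
  have [V GV Vx] : (\bigcup_(V in G) V) x by apply: cov; rewrite sub0r absvN.
  exists (index V q); rewrite nth_index; last by move: GV; rewrite Gq.
  by move: Vx; rewrite {1}(Hsel _ (GF _ GV)).
have tm_gt0 m : 0 < s * absv t ^+ m by rewrite mulr_gt0// exprn_gt0.
have [e He] := choice (fun m => ball_net _ (tm_gt0 m)).
pose dec k := odflt (0, 0)%N (unpickle k : option (nat * nat)).
exists (fun k => (t ^+ (dec k).1)^-1 * e (dec k).1 (dec k).2) => x.
have [m xm] : exists m, absv (t ^+ m * x) <= r0.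
  have : (fun k => absv t ^+ k) @ \oo --> 0.
    by apply: cvg_expr; rewrite ger0_norm ?ltW.
  have x1 : 0 < absv x + 1 by rewrite ltr_wpDl// absv_ge0.
  move=> /cvgrPdist_le/(_ _ (divr_gt0 r0_gt0 x1))[N _ /(_ N (leqnn N))] /=.
  rewrite sub0r normrN ger0_norm ?(exprn_ge0 _ (ltW t0))// => xN.
  exists N; rewrite absvM// absvX//; move: xN; rewrite ler_pdivlMr//.
  apply: le_trans; rewrite ler_wpM2l ?exprn_ge0 ?ltW//.
  by rewrite ltrDl.
have [k xk] := He m _ xm.
exists (pickle (m, k)); rewrite /dec pickleK /= /distK.
have tm0 : t ^+ m != 0 by rewrite expf_neq0// -(absv_gt0 habs).
have -> : (t ^+ m)^-1 * e m k - x = (t ^+ m)^-1 * (e m k - t ^+ m * x).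
  by rewrite mulrBr mulrA mulVf// mul1r.
rewrite absvM// absvV// absvX// mulrC ler_pdivrMr ?exprn_gt0//.
Qed.

End LocalField.

(** * Orthonormal pairs *)

Section OrthonormalPair.
Variables (R : realType) (K : fieldType) (absv : K -> R).
Hypothesis habs : nonarch_absv absv.

(* Applying the isometry hypothesis to the rows of the adjugate gives |det| = 1. *)
Lemma orthonormal_pair_inv (a11 a12 a21 a22 : K) :
  orthonormal_pair absv a11 a12 a21 a22 ->
  exists b11 b12 b21 b22,
  [/\ [/\ absv a11 <= 1, absv a12 <= 1, absv a21 <= 1 & absv a22 <= 1],
      [/\ absv b11 <= 1, absv b12 <= 1, absv b21 <= 1 & absv b22 <= 1],
      [/\ b11 * a11 + b12 * a21 = 1, b11 * a12 + b12 * a22 = 0,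
          b21 * a11 + b22 * a21 = 0 & b21 * a12 + b22 * a22 = 1] &
      [/\ a11 * b11 + a12 * b21 = 1, a11 * b12 + a12 * b22 = 0,
          a21 * b11 + a22 * b21 = 0 & a21 * b12 + a22 * b22 = 1]].
Proof.
case=> h1 h2 h.
have [a11_le a12_le] : absv a11 <= 1 /\ absv a12 <= 1.
  by rewrite -h1 !le_max !lexx orbT.
have [a21_le a22_le] : absv a21 <= 1 /\ absv a22 <= 1.
  by rewrite -h2 !le_max !lexx orbT.
pose D := a11 * a22 - a12 * a21.
have D1 : absv D = Num.max (absv a22) (absv a12).
  have := h a22 (- a12).
  rewrite (_ : _ * a12 + _ = 0); last by rewrite mulNr mulrC subrr.
  rewrite (_ : _ * a11 + _ = D); last by rewrite /D mulNr mulrC.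
  by rewrite (absv0 habs) absvN// => <-; apply/esym/max_idPl; exact: absv_ge0.
have D2 : absv D = Num.max (absv a21) (absv a11).
  have := h a21 (- a11).
  rewrite (_ : _ * a11 + _ = 0); last by rewrite mulNr mulrC subrr.
  rewrite (_ : _ * a12 + _ = - D); last by rewrite /D mulNr opprB mulrC.
  by rewrite (absv0 habs) !absvN// => <-; apply/esym/max_idPr; exact: absv_ge0.
have aD : absv D = 1.
  apply/eqP; rewrite eq_le; apply/andP; split; first by rewrite D1 ge_max a22_le.
  rewrite -h1 ge_max; apply/andP; split; first by rewrite D2 le_max lexx orbT.
  by rewrite D1 le_max lexx orbT.
have D0 : D != 0 by rewrite -(absv_gt0 habs) aD.
exists (a22 / D), (- a12 / D), (- a21 / D), (a11 / D).
split; first by [].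
- by rewrite !absvM// absvV// aD invr1 !mulr1 !absvN.
- by split; rewrite /D in D0 *; field.
- by split; rewrite /D in D0 *; field.
Qed.

Lemma orthonormal_pair_shear (a : K) : absv a <= 1 -> orthonormal_pair absv 1 a 0 1.
Proof.
move=> a1; split; rewrite ?(absv1 habs) ?(absv0 habs).
- exact/max_idPl.
- by apply/max_idPr; exact: ler01.
move=> c1 c2; rewrite mulr0 addr0 !mulr1.
have ca : absv (c1 * a) <= absv c1 by rewrite absvM// ler_piMr// absv_ge0.
apply/eqP; rewrite eq_le !ge_max !le_max lexx /=; apply/andP; split.
  rewrite -le_max; apply: le_trans (absvD habs _ _) _.
  by rewrite ge_max !le_max ca lexx orbT.
rewrite -le_max -{1}(addKr (c1 * a) c2); apply: le_trans (absvD habs _ _) _.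
by rewrite ge_max absvN// !le_max ca lexx orbT.
Qed.

Variables (V : lmodType K) (nrm : V -> R).
Hypothesis hn : nonarch_norm absv nrm.

(** The matrix and its inverse both have entries in the ring of integers, so neither increases the
    norm. *)
Lemma orthonormal_pair_isometry (a11 a12 a21 a22 : K) (x y : V) s :
  orthonormal_pair absv a11 a12 a21 a22 ->
  (nrm (a11 *: x + a12 *: y) <= s /\ nrm (a21 *: x + a22 *: y) <= s) <->
  (nrm x <= s /\ nrm y <= s).
Proof.
move=> /orthonormal_pair_inv[b11 [b12 [b21 [b22 [[? ? ? ?] [? ? ? ?] [e1 e2 e3 e4] _]]]]].
have comb (b c : K) (w z : V) : absv b <= 1 -> absv c <= 1 ->
    nrm w <= s -> nrm z <= s -> nrm (b *: w + c *: z) <= s.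
  by move=> *; apply: (nonarch_norm_le hn); exact: (nonarch_normZ_le hn).
split=> -[hx hy]; last by split; exact: comb.
have inv (b c : K) : b *: (a11 *: x + a12 *: y) + c *: (a21 *: x + a22 *: y) =
    (b * a11 + c * a21) *: x + (b * a12 + c * a22) *: y.
  by rewrite !scalerDr !scalerA addrACA -!scalerDl.
split.
  by have := inv b11 b12; rewrite e1 e2 scale1r scale0r addr0 => <-; exact: comb.
by have := inv b21 b22; rewrite e3 e4 scale1r scale0r add0r => <-; exact: comb.
Qed.

(** The isometry is applied to the differences [u - X1 w] and [v - X2 w]. *)
Lemma orthonormal_pair_cball (T : Type) (X1 X2 : T -> V) (a11 a12 a21 a22 : K) u v s :
  orthonormal_pair absv a11 a12 a21 a22 ->
  (fun w => (a11 *: X1 w + a12 *: X2 w, a21 *: X1 w + a22 *: X2 w)) @^-1`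
    cball (distV2 nrm) (a11 *: u + a12 *: v, a21 *: u + a22 *: v) s =
  X1 @^-1` cball (distV nrm) u s `&` X2 @^-1` cball (distV nrm) v s.
Proof.
move=> ha; rewrite cball_distV2; apply/seteqP.
have sub (b c : K) w : b *: (u - X1 w) + c *: (v - X2 w) =
    b *: u + c *: v - (b *: X1 w + c *: X2 w).
  by rewrite !scalerBr addrACA -opprD.
have E w := orthonormal_pair_isometry (u - X1 w) (v - X2 w) s ha.
by split => w; have := E w; rewrite !sub /cball /distV /= => Ew /Ew.
Qed.

Lemma orthonormal_pair_surj (a11 a12 a21 a22 : K) (x y : V) :
  orthonormal_pair absv a11 a12 a21 a22 ->
  exists u v, a11 *: u + a12 *: v = x /\ a21 *: u + a22 *: v = y.
Proof.
move=> /orthonormal_pair_inv[b11 [b12 [b21 [b22 [_ _ _ [f1 f2 f3 f4]]]]]].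
exists (b11 *: x + b12 *: y), (b21 *: x + b22 *: y).
split; rewrite !scalerDr !scalerA addrACA -!scalerDl.
  by rewrite f1 f2 scale0r scale1r addr0.
by rewrite f3 f4 scale0r scale1r add0r.
Qed.

End OrthonormalPair.

(** * Ball probabilities under orthonormal pairs *)

Section GaussianBalls.
Variables (R : realType) (K : fieldType) (absv : K -> R).
Hypothesis habs : nonarch_absv absv.
Variables (V : lmodType K) (nrm : V -> R).
Hypothesis hn : nonarch_norm absv nrm.
Variables (d : measure_display) (T : measurableType d) (P : probability T R).
Variable X : T -> V.
Hypothesis hX : KGaussian absv nrm P X.

(** The two projections of the product space [P \x P] are independent copies of [X]; the Gaussian
    property is tested on them with a ball of [V * V], whose probability factors on both sides. *)
Lemma gaussian_balls (a11 a12 a21 a22 : K) (u v : V) (s : R) : 0 < s ->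
  orthonormal_pair absv a11 a12 a21 a22 ->
  (P (X @^-1` cball (distV nrm) (a11 *: u + a12 *: v)%R s) *
   P (X @^-1` cball (distV nrm) (a21 *: u + a22 *: v)%R s) =
   P (X @^-1` cball (distV nrm) u s) * P (X @^-1` cball (distV nrm) v s))%E.
Proof.
move=> s0 ha; case: hX => rX gX.
have dU := distV_ultrametric habs hn.
have d2U := distV2_ultrametric habs hn.
pose P' : probability (T * T)%type R := (P \x P)%E.
pose X1 : T * T -> V := X \o fst; pose X2 : T * T -> V := X \o snd.
have X1E B : X1 @^-1` B = (X @^-1` B) `*` setT.
  by apply/seteqP; split => -[w w'] //= -[].
have X2E B : X2 @^-1` B = setT `*` (X @^-1` B).
  by apply/seteqP; split => -[w w'] //= -[].
have PE A B : measurable A -> measurable B -> (P' (A `*` B) = P A * P B)%E.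
  by move=> mA mB; exact: product_measure1E.
have rect A B : mborel (distV nrm) A -> mborel (distV nrm) B ->
    (P' (X1 @^-1` A `&` X2 @^-1` B) = P (X @^-1` A) * P (X @^-1` B))%E.
  move=> mA mB; rewrite X1E X2E -setXI setIT setTI PE//; exact: rX.
have rX1 : is_rv nrm X1 by move=> B mB; rewrite X1E; apply: measurableX => //; exact: rX.
have rX2 : is_rv nrm X2 by move=> B mB; rewrite X2E; apply: measurableX => //; exact: rX.
have l1 : same_law nrm P' X1 P X.
  by move=> B mB; rewrite X1E PE ?probability_setT ?mule1//; exact: rX.
have l2 : same_law nrm P' X2 P X.
  by move=> B mB; rewrite X2E PE ?probability_setT ?mul1e//; exact: rX.
have ind : indep2 nrm P' X1 X2 by move=> A B mA mB; rewrite rect// l1// l2.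
have mu s' := cball_mborel dU s' s0.
have := gX _ _ P' X1 X2 rX1 rX2 l1 l2 ind _ _ _ _ ha _ (cball_mborel d2U
  (a11 *: u + a12 *: v, a21 *: u + a22 *: v)%R s0).
rewrite (orthonormal_pair_cball habs hn _ _ _ _ _ ha) cball_distV2 rect// => ->.
by apply/esym; exact: rect.
Qed.

Lemma gaussian_shear (a : K) (u v : V) (s : R) : 0 < s -> absv a <= 1 ->
  (P (X @^-1` cball (distV nrm) (u + a *: v)%R s) * P (X @^-1` cball (distV nrm) v s) =
   P (X @^-1` cball (distV nrm) u s) * P (X @^-1` cball (distV nrm) v s))%E.
Proof.
move=> s0 a1; rewrite -(gaussian_balls u v s0 (orthonormal_pair_shear habs a1)).
by rewrite !scale1r scale0r add0r.
Qed.

End GaussianBalls.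

(** * The support of a Gaussian law *)

Section GaussianSupport.
Variables (R : realType) (K : fieldType) (absv : K -> R).
Hypothesis habs : nonarch_absv absv.
Variables (V : lmodType K) (nrm : V -> R).
Hypothesis hn : nonarch_norm absv nrm.
Hypothesis hnets : countable_nets (distV nrm).
Variables (d : measure_display) (T : measurableType d) (P : probability T R).
Variable X : T -> V.
Hypothesis hX : KGaussian absv nrm P X.

Let dU := distV_ultrametric habs hn.

(** The function [f_s] of the overview, real-valued so that positive factors cancel. *)
Definition ball_prob (s : R) (u : V) : R := fine (P (X @^-1` cball (distV nrm) u s)).

Lemma ball_measurable s u : 0 < s -> measurable (X @^-1` cball (distV nrm) u s).
Proof. by move=> s0; apply: (proj1 hX); exact: (cball_mborel dU). Qed.

Lemma ball_probE s u : 0 < s -> P (X @^-1` cball (distV nrm) u s) = (ball_prob s u)%:E.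
Proof. by move=> s0; rewrite fineK// fin_num_measure//; exact: ball_measurable. Qed.

Lemma ball_prob_ge0 s u : 0 <= ball_prob s u.
Proof. by apply: fine_ge0. Qed.

Lemma ball_prob_shear s a u v : 0 < s -> absv a <= 1 -> 0 < ball_prob s v ->
  ball_prob s (u + a *: v) = ball_prob s u.
Proof.
move=> s0 a1 v0; have := gaussian_shear habs hn hX u v s0 a1.
by rewrite !ball_probE// -!EFinM => -[] /(mulIf (lt0r_neq0 v0)).
Qed.

(** Where it fails, [X w] lies in a net ball of probability zero, since [ball_prob s] is constant on
    balls of radius [s]; there are only countably many such balls. *)
Lemma ball_prob_gt0_ae s : 0 < s -> {ae P, forall w, 0 < ball_prob s (X w)}.
Proof.
move=> s0; have [e He] := hnets s0.
pose F k := if ball_prob s (e k) == 0 then X @^-1` cball (distV nrm) (e k) s else set0.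
apply: (@negligibleS _ _ _ _ (\bigcup_k F k)).
  move=> w /= /negP; rewrite -leNgt => w0.
  have [k ke] := He (X w); exists k => //; rewrite /F.
  have -> : ball_prob s (e k) = ball_prob s (X w) by rewrite /ball_prob (cball_eq dU ke).
  by rewrite eq_le w0 ball_prob_ge0.
apply: negligible_bigcup => k; rewrite /F; case: ifPn => [/eqP k0|_]; last first.
  exact: negligible_set0.
apply/negligibleP; first exact: ball_measurable.
by have := ball_probE (e k) s0; rewrite k0.
Qed.

(** Some value [v = X w] has a ball of positive probability, and the shear with [a = -1] moves its
    centre to [v - v = 0]. *)
Lemma ball_prob_0_gt0 s : 0 < s -> 0 < ball_prob s 0.
Proof.
move=> s0.
have P0 : (0 < P [set: T])%E by rewrite probability_setT lte01.
have := ae_properfilter_algebraOfSetsType P0 => PF.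
have [w Xw] := filter_ex (ball_prob_gt0_ae s0).
have N1 : absv (-1) <= 1 by rewrite absvN// (absv1 habs).
by have := ball_prob_shear (X w) s0 N1 Xw; rewrite scaleN1r subrr => ->.
Qed.

Lemma ball_prob_gt0_comb s a u v : 0 < s -> absv a <= 1 ->
  0 < ball_prob s u -> 0 < ball_prob s v -> 0 < ball_prob s (u + a *: v).
Proof. by move=> *; rewrite ball_prob_shear. Qed.

Lemma ball_prob_gt0_small s v : 0 < s -> nrm v <= s -> 0 < ball_prob s v.
Proof.
move=> s0 vs; rewrite /ball_prob (cball_eq dU (y := 0)); first exact: ball_prob_0_gt0.
by rewrite /distV subr0.
Qed.

(* A ball of probability more than 1/2 has no disjoint translate of the same probability. *)
Lemma gaussian_bounded : exists2 M, 0 < M & {ae P, forall w, nrm (X w) <= M}.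
Proof.
pose F n := X @^-1` cball (distV nrm) 0 n.+1%:R.
have mF n : measurable (F n) by exact: ball_measurable.
have UF : \bigcup_n F n = setT.
  apply/seteqP; split => // w _.
  exists (Num.truncn (nrm (X w))) => //; rewrite /F /cball /distV /= sub0r.
  by rewrite (nonarch_normN habs hn) ltW// truncnS_gt.
(* The balls about 0 increase to the whole space, so their probabilities tend to 1 and cannot all
   stay below 1/2. *)
have [n Fn] : exists n, (2^-1%:E < P (F n))%E.
  apply: contrapT => /forallNP H.
  have ndF : {homo F : n m / (n <= m)%N >-> (n <= m)%O}.
    move=> n m nm; apply/subsetPset => w; rewrite /F /cball /= => /le_trans; apply.
    by rewrite ler_nat.
  have mUF : measurable (\bigcup_n F n) by rewrite UF.
  have cF : (P \o F) x @[x --> \oo] --> 1%E.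
    by rewrite -(probability_setT P) -UF; exact: nondecreasing_cvg_mu mF mUF ndF.
  have : (limn (P \o F) <= 2^-1%:E)%E.
    apply: lime_le; first by apply/cvg_ex; eexists; exact: cF.
    by apply: nearW => n /=; rewrite leNgt; apply/negP; exact: H.
  rewrite (cvg_lim _ cF)// lee_fin leNgt invf_lt1//.
  by rewrite ltr1n.
have M0 : 0 < n.+1%:R :> R by [].
exists n.+1%:R => //; apply: filterS (ball_prob_gt0_ae M0) => w Xw.
(* The bound is the radius itself: almost surely the shear identity at this scale gives the balls
   about 0 and about [X w] equal probability. *)
have N1 : absv 1 <= 1 by rewrite (absv1 habs).
have := ball_prob_shear 0 M0 N1 Xw; rewrite scale1r add0r => E.
rewrite leNgt; apply/negP => Mw.
pose G := X @^-1` cball (distV nrm) (X w) n.+1%:R.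
have mG : measurable G by exact: ball_measurable.
have PF : P (F n) = (ball_prob n.+1%:R 0)%:E by exact: ball_probE.
have PG : P G = (ball_prob n.+1%:R 0)%:E by rewrite -E; exact: ball_probE.
have : (P (F n) + P G <= 1)%E.
  have <- : P (F n `|` G) = (P (F n) + P G)%E.
    apply: measureU => //; apply/seteqP; split => // w' [h1 h2].
    move: Mw; rewrite ltNge => /negP; apply; case: dU => _ dC dD.
    have -> : nrm (X w) = distV nrm (X w) 0 by rewrite /distV subr0.
    by apply: le_trans (dD _ (X w') _) _; rewrite ge_max [distV _ _ 0]dC; apply/andP.
  by apply: probability_le1; exact: measurableU.
move: Fn; rewrite PF PG -EFinD lte_fin lee_fin => Fn.
rewrite leNgt => /negP; apply.
by rewrite [ltLHS]splitr mul1r; exact: ltrD.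
Qed.

End GaussianSupport.

(** * Separation of lattices *)

Section Lattice.
Variables (R : realType) (K : fieldType) (absv : K -> R).
Hypothesis hK : local_field_absv absv.

Let habs : nonarch_absv absv. Proof. by case: hK. Qed.

Lemma absv_det_le n (A : 'M[K]_n) M : (forall i j, absv (A i j) <= M) ->
  absv (\det A) <= M ^+ n.
Proof.
case: n A => [|n] A AM; first by rewrite det_mx00 (absv1 habs).
have M0 : 0 <= M by apply: le_trans (AM ord0 ord0); exact: absv_ge0.
rewrite /determinant; apply: (absv_sum_le habs) => [|g _]; first exact: exprn_ge0.
rewrite absvM// absvX// absvN// (absv1 habs) expr1n mul1r absv_prod//.
have -> : M ^+ n.+1 = \prod_(i < n.+1) M by rewrite prodr_const card_ord.
by apply: ler_prod => i _; rewrite (absv_ge0 habs) AM.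
Qed.

(** Cramer's rule, by cofactor expansion along the replaced row [j]. *)
Lemma mulmx_invmx_coord n (A : 'M[K]_n) (x : 'rV[K]_n) (j : 'I_n) : A \in unitmx ->
  (x *m invmx A) ord0 j =
  \det (\matrix_(i, k) if i == j then x ord0 k else A i k) / \det A.
Proof.
move=> Au; set B := (\matrix_(_, _) _).
rewrite /invmx Au -scalemxAr mxE mulrC; congr (_ / _).
rewrite (expand_det_row B j) mxE; apply: eq_bigr => k _.
rewrite !mxE eqxx /cofactor; congr (_ * (_ * \det _)).
by apply/matrixP => a b; rewrite !mxE eq_sym (negPf (neq_lift _ _)).
Qed.

(* An almost optimal [\det A] over the matrices with rows in [L] makes the
   coordinates of [L] in the rows of [A] integral, so that the columns of
   [invmx A] separate [L] from the points outside it. *)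
Lemma lattice_separation n (L : set 'rV[K]_n) (s M : R) : 0 < s ->
  (forall x, maxnorm absv x <= s -> L x) ->
  (forall x, L x -> maxnorm absv x <= M) ->
  (forall a x y, absv a <= 1 -> L x -> L y -> L (x + a *: y)) ->
  forall v, ~ L v -> exists b : 'I_n -> K,
    (forall x, L x -> absv (\sum_i b i * x ord0 i) <= 1) /\
    1 < absv (\sum_i b i * v ord0 i).
Proof.
move=> s0 sL LM Lcomb v nLv.
have [r /andP[r0 r1] gap] := absv_gap hK.
have L0 : L 0.
  apply: sL; apply/maxnorm_leP; first exact: ltW.
  by move=> i; rewrite mxE (absv0 habs) ltW.
pose S : set R := [set absv (\det A) | A in [set A : 'M[K]_n | forall i, L (row i A)]].
have Sbound : ubound S (M ^+ n).
  move=> _ [A LA <-]; apply: absv_det_le => i j.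
  by have := le_trans (absv_coord_le _ _ j) (LM _ (LA i)); rewrite mxE.
(* The scalar matrix [t] has its rows in the ball of radius [s], hence in [L]; this makes the
   supremum positive. *)
have [t t0 ts] := absv_small hK s0.
have St : S (absv (\det (t%:M : 'M[K]_n))).
  exists t%:M => //= i; apply: sL; apply/maxnorm_leP; first exact: ltW.
  by move=> j; rewrite !mxE; case: eqP => _; rewrite ?mulr1n ?mulr0n ?(absv0 habs)// ltW.
have hS : has_sup S by split; [eexists; exact: St|eexists; exact: Sbound].
have supS0 : 0 < sup S.
  apply: lt_le_trans (ub_le_sup (proj2 hS) St).
  by rewrite det_scalar absvX// exprn_gt0.
have e0 : 0 < (1 - r) * sup S by rewrite mulr_gt0// subr_gt0.
have [_ [A LA <-] SA] := sup_adherent e0 hS.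
have rA : r * sup S < absv (\det A).
  by apply: le_lt_trans SA; rewrite mulrBl mul1r opprB addrC subrK.
have dA0 : 0 < absv (\det A) by apply: lt_trans rA; rewrite mulr_gt0.
have Au : A \in unitmx by rewrite unitmxE unitfE -(absv_gt0 habs).
have int x j : L x -> absv ((x *m invmx A) ord0 j) <= 1.
  move=> Lx; rewrite mulmx_invmx_coord//; set B := (\matrix_(_, _) _).
  have SB : absv (\det B) <= sup S.
    apply: (ub_le_sup (proj2 hS)); exists B => //= i.
    suff -> : row i B = if i == j then x else row i A by case: eqP.
    by apply/rowP => k; rewrite !mxE; case: eqP => _ //; rewrite mxE.
  rewrite leNgt; apply/negP => B1.
  have B0 : 0 < absv (\det B).
    rewrite (absv_gt0 habs); apply/eqP => B0; move: B1.
    by rewrite B0 mul0r (absv0 habs) ltNge ler01.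
  (* The gap below 1 turns near-optimality into integrality: if [\det B] were larger than [\det A],
     then [absv (\det A)] would be at most [r * sup S]. *)
  have : absv (\det A / \det B) <= r.
    apply: gap; move: B1; rewrite !(absvM habs) !(absvV habs) ltr_pdivlMr// mul1r.
    by rewrite ltr_pdivrMr// mul1r.
  rewrite (absvM habs) (absvV habs) ler_pdivrMr// leNgt => /negP; apply.
  by apply: le_lt_trans rA; rewrite ler_pM2l.
(* If all coordinates of [v] were integral, [v] would be an integral combination of the rows of [A]
   and so lie in [L]. *)
have [j vj] : exists j, 1 < absv ((v *m invmx A) ord0 j).
  apply: contrapT => /forallNP nv; apply: nLv.
  have -> : v = \sum_j (v *m invmx A) ord0 j *: row j A.
    by rewrite -mulmx_sum_row mulmxKV.
  elim/big_rec: _ => // j x _ Lx; rewrite addrC; apply: Lcomb => //.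
  by rewrite leNgt; apply/negP; exact: nv.
have E (x : 'rV[K]_n) : \sum_i invmx A i j * x ord0 i = (x *m invmx A) ord0 j.
  by rewrite mxE; apply: eq_bigr => i _; rewrite mulrC.
exists (fun i => invmx A i j); split => [x Lx|]; rewrite E//.
exact: int.
Qed.

End Lattice.

(** * Independence implies orthogonality *)

Section GaussianVector.
Variables (R : realType) (K : fieldType) (absv : K -> R).
Hypothesis hK : local_field_absv absv.
Variables (n : nat) (d : measure_display) (T : measurableType d).
Variables (P : probability T R) (X : T -> 'rV[K]_n).
Hypothesis hX : KGaussian absv (maxnorm absv (n := n)) P X.

Let habs : nonarch_absv absv. Proof. by case: hK. Qed.
Let hn := nonarch_norm_maxnorm habs n.
Let hnets : countable_nets (distV (maxnorm absv (n := n))) :=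
  maxnorm_nets n (local_field_nets hK).
Let distK := fun a b : K => absv (a - b).

Lemma coord_mborel i B : mborel distK B ->
  mborel (distV (maxnorm absv (n := n))) [set x | B (x ord0 i)].
Proof.
move=> mB; apply: (mborel_preimage_lip (dist' := distK)
  (f := fun x : 'rV[K]_n => x ord0 i)) mB => x y.
by have := absv_coord_le absv (x - y) i; rewrite !mxE.
Qed.

Lemma coord_measurable i B : mborel distK B -> measurable [set w | B (X w ord0 i)].
Proof. by move=> /(coord_mborel i); exact: (proj1 hX). Qed.

Lemma coord_Linf_fin i : Linf_norm absv P (fun w => X w ord0 i) \is a fin_num.
Proof.
have P0 : (0 < P [set: T])%E by rewrite probability_setT lte01.
have [M M0 XM] := gaussian_bounded habs hn hnets hX.
rewrite ge0_fin_numE; last first.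
  by apply: ess_sup_ger => // w; rewrite lee_fin absv_ge0.
apply: le_lt_trans (ltry M); apply/ess_supP; apply: filterS XM => w XM.
by rewrite lee_fin; apply: le_trans XM; exact: absv_coord_le.
Qed.

(** The set is open: displacements below [r / (absv a + 1)] preserve it, where the added 1 covers
    [a = 0]. *)
Lemma mborel_saturated (a : K) r (B : set K) : 0 < r ->
  (forall x y, absv (a * (x - y)) <= r -> B x -> B y) -> mborel distK B.
Proof.
move=> r0 sB; apply: mopen_mborel => x Bx.
have a1 : 0 < absv a + 1 by rewrite ltr_wpDl// absv_ge0.
exists (r / (absv a + 1)); first by rewrite divr_gt0.
move=> y /ltW; rewrite ler_pdivlMr// => xy; apply: sB Bx.
rewrite (absvM habs) mulrC; apply: le_trans xy.
by rewrite ler_wpM2l ?absv_ge0// lerDl.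
Qed.

Lemma indep_Linf_orthogonal :
  indep absv P (fun i w => X w ord0 i) -> Linf_orthogonal absv P (fun i w => X w ord0 i).
Proof.
move=> ind; have P0 : (0 < P [set: T])%E by rewrite probability_setT lte01.
split=> [i|S al].
  split; first by move=> B; exact: coord_measurable.
  by move: (coord_Linf_fin i); rewrite fin_numE ltey => /andP[].
apply/eqP; rewrite eq_le; apply/andP; split.
  (* This inequality is the ultrametric inequality, almost everywhere. *)
  set M := (X in (_ <= X)%E).
  have M0 : (0 <= M)%E by rewrite /M; elim/big_rec: _ => // i x _; rewrite le_max orbC => ->.
  apply/ess_supP.
  have : {ae P, forall w i, ((absv (X w ord0 i))%:E <=
      Linf_norm absv P (fun w => X w ord0 i))%E}.
    by apply: filter_forall => i; exact: ess_sup_ge.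
  apply: filterS => w Hw.
  case EM : M M0 => [m||] // m0; last by rewrite leey.
  rewrite lee_fin; apply: (absv_sum_le habs) => // i iS.
  rewrite (absvM habs) -lee_fin -EM EFinM.
  apply: (@le_trans _ _ ((absv (al i))%:E * Linf_norm absv P (fun w => X w ord0 i))%E).
    by apply: lee_wpmul2l; [rewrite lee_fin absv_ge0|exact: Hw].
  exact: (le_bigmax_cond _ (fun i => ((absv (al i))%:E * Linf_norm absv P (fun w => X w ord0 i))%E)).
set N := (X in (_ <= X)%E).
have N0 : (0 <= N)%E by apply: ess_sup_ger => // w; rewrite lee_fin absv_ge0.
apply: bigmax_le => // j jS.
case EN : N N0 => [r||] // r0; last by rewrite leey.
apply/lee_addgt0Pr => e e0; rewrite -EFinD.
(* The slack [e] gives a positive threshold even when the norm of the sum is zero. *)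
have re0 : 0 < r + e by rewrite ltr_wpDl.
rewrite -ess_supZl ?absv_ge0//; apply/ess_supP.
set re := r + e in re0 *.
(* In the joint event, term [j] exceeds [re] while the other terms of the sum do not. The sum then
   exceeds its essential supremum, so the event is null and, by independence, some factor
   vanishes. *)
pose B i := if i == j then [set x | re < absv (al j * x)]
  else if i \in S then [set x | absv (al i * x) <= re] else [set: K].
have mB i : mborel distK (B i).
  rewrite /B; case: eqP => _; [apply: (mborel_saturated (a := al j) re0)|
    case: ifP => _; [apply: (mborel_saturated (a := al i) re0)|
                     exact: (mborel_saturated (a := 0) re0)]].
    move=> x y xy /= hx; have -> : al j * y = al j * x + - (al j * (x - y)) by ring.
    by apply: (absvD_gt habs) => //; rewrite absvN.
  move=> x y xy /= hx; have -> : al i * y = al i * x + - (al i * (x - y)) by ring.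
  by apply: le_trans (absvD habs _ _) _; rewrite ge_max hx absvN.
have mXB i : measurable [set w | B i (X w ord0 i)] by exact: coord_measurable.
have PB i : P [set w | B i (X w ord0 i)] = (fine (P [set w | B i (X w ord0 i)]))%:E.
  by rewrite fineK// fin_num_measure.
have := ind B mB.
have -> : P (\bigcap_(i in [set: 'I_n]) ((fun w => X w ord0 i) @^-1` B i)) = 0%E.
  apply: measure_negligible.
    by apply: fin_bigcap_measurable => // i _; exact: mXB.
  have := ess_sup_ge P (fun w => (absv (\sum_(i in S) al i * X w ord0 i))%:E).
  apply: negligibleS => w Bw /=; rewrite -/(Linf_norm _ _ _) -/N EN lee_fin.
  apply/negP; rewrite -ltNge (lt_trans (y := re))// ?/re ?ltrDl//.
  rewrite (bigD1 j)//=; apply: (absvD_gt habs).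
    apply: (absv_sum_le habs) => [|i /andP[iS ij]]; first exact: ltW.
    by have := Bw i I; rewrite /B /= (negPf ij) iS.
  by have := Bw j I; rewrite /B /= eqxx.
rewrite (eq_bigr (fun i => (fine (P [set w | B i (X w ord0 i)]))%:E)); last first.
  by move=> i _; exact: PB.
rewrite prodEFin => /esym -[] /eqP; rewrite prodf_seq_eq0 => /hasP[i _ /= /eqP Pi].
have {Pi}Pi : P [set w | B i (X w ord0 i)] = (0 : R)%:E by rewrite PB Pi.
have [ij|ij] := eqVneq i j.
  apply: (@negligibleS _ _ _ _ _ _ _ (proj2 (negligibleP _ (mXB i)) Pi)) => w /=.
  move=> /negP; rewrite -ltNge ij /B eqxx /= -EFinM lte_fin.
  by rewrite (absvM habs).
(* No factor with [i != j] vanishes: its event contains the event that [X] lies in a small ball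
   about 0, which has positive probability. *)
exfalso; have a1 : 0 < absv (al i) + 1 by rewrite ltr_wpDl// absv_ge0.
pose s := re / (absv (al i) + 1); have s0 : 0 < s by rewrite divr_gt0.
have := ball_prob_0_gt0 habs hn hnets hX s0.
rewrite ltNge => /negP; apply; rewrite -lee_fin -(ball_probE habs hn hX)// -Pi.
apply: le_measure; rewrite ?inE//; first exact: (ball_measurable habs hn hX).
move=> w /=; rewrite /cball /distV /= sub0r (nonarch_normN habs hn) => ws.
rewrite /B (negPf ij); case: ifP => //= _; rewrite (absvM habs) mulrC.
have := le_trans (absv_coord_le absv (X w) i) ws.
rewrite /s ler_pdivlMr//; apply: le_trans.
by rewrite ler_wpM2l ?absv_ge0// lerDl.
Qed.

End GaussianVector.

(** * Orthogonality implies independence *)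

Lemma mborel_setI (R : realType) (W : Type) (dist : W -> W -> R) :
  setI_closed (mborel dist).
Proof.
by have /sigma_algebraP[] := smallest_sigma_algebra setT (mopen dist).
Qed.

Lemma mborel_setC (R : realType) (W : Type) (dist : W -> W -> R) A :
  mborel dist A -> mborel dist (~` A).
Proof.
by move=> mA; rewrite -setTD; case: (smallest_sigma_algebra setT (mopen dist)) => _ + _; apply.
Qed.

Lemma probability_setI_ae (R : realType) d (T : measurableType d) (P : probability T R)
    (C G : set T) : measurable C -> measurable G -> {ae P, forall w, G w} ->
  P (C `&` G) = P C.
Proof.
move=> mC mG aeG; have := measureDI P mC mG.
rewrite [X in _ = (X + _)%E -> _](_ : _ = 0%E) ?add0e//.
apply: measure_negligible; first exact: measurableD.
by apply: negligibleS aeG => w [].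
Qed.

Section GaussianIndep.
Variables (R : realType) (K : fieldType) (absv : K -> R).
Hypothesis hK : local_field_absv absv.

Let habs : nonarch_absv absv. Proof. by case: hK. Qed.
Let distK := fun a b : K => absv (a - b).
Let ultraK : ultrametric distK := distV_ultrametric habs (nonarch_norm_absv habs).

(** Once [f w] is within [s] of a net point [e k], the sum is within [s] of [c] exactly when [g w]
    is within [s] of [c - e k]. *)
Lemma measurable_preimageD d (Omega : measurableType d) (f g : Omega -> K) :
  (forall B, mborel distK B -> measurable (f @^-1` B)) ->
  (forall B, mborel distK B -> measurable (g @^-1` B)) ->
  forall B, mborel distK B -> measurable ((fun w => f w + g w) @^-1` B).
Proof.
move=> mf mg; apply: (measurable_preimage_balls ultraK (local_field_nets hK)) => c s s0.
have [e He] := local_field_nets hK s0.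
have -> : (fun w => f w + g w) @^-1` cball distK c s = \bigcup_k
    (f @^-1` cball distK (e k) s `&` g @^-1` cball distK (c - e k) s).
  apply/seteqP; split => w /=.
    move=> cfg; have [k kf] := He (f w); exists k => //; split => //.
    rewrite /cball /= /distK.
    have -> : c - e k - g w = (c - (f w + g w)) + - (e k - f w) by ring.
    by apply: le_trans (absvD habs _ _) _; rewrite ge_max (absvN habs); apply/andP.
  move=> [k _ [/= kf kg]]; rewrite /cball /= /distK.
  have -> : c - (f w + g w) = (c - e k - g w) + (e k - f w) by ring.
  by apply: le_trans (absvD habs _ _) _; rewrite ge_max; apply/andP.
apply: bigcupT_measurable => k; apply: measurableI.
  by apply: mf; exact: (cball_mborel ultraK).
by apply: mg; exact: (cball_mborel ultraK).
Qed.

(** The complement is open. Arguing by the complement includes [r = 0], where the set is the single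
    point 0. *)
Lemma absv_le_mborel (r : R) : mborel distK [set x | absv x <= r].
Proof.
rewrite -(setCK [set x | absv x <= r]); apply: mborel_setC; apply: mopen_mborel => x /=.
move=> /negP; rewrite -ltNge => rx.
have [r0|r0] := leP 0 r; last first.
  by exists 1 => // y _; apply/negP; rewrite -ltNge (lt_le_trans r0)// absv_ge0.
exists (absv x); first exact: le_lt_trans rx.
move=> y xy; apply/negP; rewrite -ltNge ltNge; apply/negP => yr.
have : absv x < absv x; last by rewrite ltxx.
rewrite -{1}(subrK y x); apply: le_lt_trans (absvD habs _ _) _.
by rewrite gt_max xy (le_lt_trans yr).
Qed.

Variables (n : nat) (d : measure_display) (T : measurableType d).
Variables (P : probability T R) (X : T -> 'rV[K]_n).
Hypothesis hX : KGaussian absv (maxnorm absv (n := n)) P X.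

Let hn := nonarch_norm_maxnorm habs n.
Let hnets : countable_nets (distV (maxnorm absv (n := n))) :=
  maxnorm_nets n (local_field_nets hK).
Let distn := distV (maxnorm absv (n := n)).

Hypothesis orth : Linf_orthogonal absv P (fun i w => X w ord0 i).

Let Linf i := Linf_norm absv P (fun w => X w ord0 i).

Lemma orthogonal_ball_prob_gt0 i y s : 0 < s -> ((absv y)%:E <= Linf i)%E ->
  0 < ball_prob (maxnorm absv (n := n)) P X s (y *: delta_mx ord0 i).
Proof.
move=> s0 yi; apply: contrapT => nL.
have [M M0 XM] := gaussian_bounded habs hn hnets hX.
(* The module is truncated to a bounded lattice; the bound [M'] keeps the ball of radius [s] inside
   and still admits [X w] almost surely. *)
pose M' := Num.max M s.
pose L := [set x | 0 < ball_prob (maxnorm absv (n := n)) P X s x /\ maxnorm absv x <= M'].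
have nLe : ~ L (y *: delta_mx ord0 i) by case.
have [||||b [bL be]] := lattice_separation hK (L := L) (s := s) (M := M') _ _ _ _ nLe.
- exact: s0.
- move=> x xs; split; first exact: (ball_prob_gt0_small habs hn hnets hX).
  by rewrite le_max xs orbT.
- by move=> x [].
- move=> a x z a1 [x0 xM] [z0 zM]; split.
    exact: (ball_prob_gt0_comb habs hn hX).
  by apply: (nonarch_norm_le hn) => //; exact: (nonarch_normZ_le hn).
move: be; rewrite (bigD1 i)//= big1 ?addr0; last first.
  by move=> k ki; rewrite !mxE eqxx (negPf ki) !mulr0.
rewrite !mxE !eqxx mulr1 ltNge => /negP; apply.
(* By orthogonality the separating functional has norm at least [absv (b i) * Linf i] on [X], but it
   is at most 1 on [L], where [X] lies almost surely. *)
rewrite -lee_fin (absvM habs) EFinM.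
apply: (@le_trans _ _ ((absv (b i))%:E * Linf i)%E).
  by apply: lee_wpmul2l => //; rewrite lee_fin absv_ge0.
have := proj2 orth [set: 'I_n]%SET b => E.
apply: (@le_trans _ _ (Linf_norm absv P (fun w => \sum_(k in [set: 'I_n]%SET) b k * X w ord0 k))).
  rewrite E; apply: (le_bigmax_cond _ (fun k => ((absv (b k))%:E * Linf k)%E)).
  by rewrite finset.in_setT.
apply/ess_supP; apply: filterS2 (ball_prob_gt0_ae habs hn hnets hX s0) XM => w w0 wM.
rewrite lee_fin (eq_bigl xpredT); last by move=> k; rewrite finset.in_setT.
by apply: bL; split => //; rewrite le_max wM.
Qed.

Lemma orthogonal_translation i y (B : set 'rV[K]_n) : ((absv y)%:E <= Linf i)%E ->
  mborel distn B ->
  P [set w | B (X w + y *: delta_mx ord0 i)] = P (X @^-1` B).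
Proof.
move=> yi; set e := y *: _.
apply: (probability_eq_balls (distV_ultrametric habs hn) hnets
  (f := fun w => X w + e)) => [C mC|C mC|u s s0].
- apply: (proj1 hX [set x | C (x + e)]).
  apply: (mborel_preimage_lip (dist' := distn) (f := fun x => x + e)) mC => x z.
  by rewrite /distn /distV opprD addrACA subrr addr0.
- exact: (proj1 hX).
have -> : (fun w => X w + e) @^-1` cball distn u s = X @^-1` cball distn (u - e) s.
  by apply/seteqP; split => w; rewrite /cball /distn /distV /= opprD addrA addrAC.
rewrite !(ball_probE habs hn hX)//; congr (_%:E).
rewrite -scaleN1r; apply: (ball_prob_shear habs hn hX) => //.
  by rewrite (absvN habs) (absv1 habs).
exact: orthogonal_ball_prob_gt0.
Qed.

(* The probability of the set [S] in the proof is computed by Fubini in two ways: conditionally on the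
   first copy, translation invariance replaces [X_i w + X_i w'] by [X_i w'],
   and conditionally on the second copy it replaces it by [X_i w]. *)
Lemma orthogonal_factor i (A : set K) (E : set 'rV[K]_n) :
  mborel distK A -> mborel distn E ->
  (forall x y, E (x + y *: delta_mx ord0 i) = E x) ->
  P ([set w | A (X w ord0 i)] `&` X @^-1` E) = (P [set w | A (X w ord0 i)] * P (X @^-1` E))%E.
Proof.
move=> mA mE invE; pose r := fine (Linf i).
have rE : Linf i = r%:E by rewrite fineK//; exact: (coord_Linf_fin hK hX).
pose XA := [set w | A (X w ord0 i)].
have mXA : measurable XA by exact: (coord_measurable hX).
have mXE : measurable (X @^-1` E) by exact: (proj1 hX).
(* On this event of probability one, [X w ord0 i] is itself an admissible translation length. *)
pose G := [set w | absv (X w ord0 i) <= r].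
have mG : measurable G.
  by exact: (coord_measurable hX i (absv_le_mborel r)).
have aeG : {ae P, forall w, G w}.
  have := ess_sup_ge P (fun w => (absv (X w ord0 i))%:E).
  by apply: filterS => w; rewrite -/(Linf_norm _ _ _) -/(Linf i) rE lee_fin.
pose F := X @^-1` E `&` G.
have mF : measurable F by exact: measurableI.
pose Sum := [set z : T * T | A (X z.1 ord0 i + X z.2 ord0 i)].
have mSum : measurable Sum.
  apply: (measurable_preimageD (f := fun z : T * T => X z.1 ord0 i)
    (g := fun z : T * T => X z.2 ord0 i)) mA => B mB.
    rewrite (_ : _ @^-1` _ = [set w | B (X w ord0 i)] `*` setT).
      by apply: measurableX => //; exact: (coord_measurable hX).
    by apply/seteqP; split => -[w w'] //= -[].
  rewrite (_ : _ @^-1` _ = setT `*` [set w | B (X w ord0 i)]).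
    by apply: measurableX => //; exact: (coord_measurable hX).
  by apply/seteqP; split => -[w w'] //= -[].
pose S := Sum `&` F `*` G.
have mS : measurable S by apply: measurableI => //; exact: measurableX.
have PF : P F = P (X @^-1` E) by exact: probability_setI_ae.
have PG : P G = 1%E by rewrite -(setTI G) probability_setI_ae ?probability_setT.
have coordE (x : 'rV[K]_n) y : (x + y *: delta_mx ord0 i) ord0 i = x ord0 i + y :> K.
  by rewrite !mxE !eqxx mulr1.
have S1 : (P \x P)%E S = (P (X @^-1` E) * P XA)%E.
  rewrite -PF -product_measure1E//; apply: eq_integral => w _ /=.
  have [wF|wF] := boolP (w \in F); last first.
    rewrite notin_xsectionX//; congr (P _); apply/seteqP; split => // w'.
    by rewrite /xsection /= in_setE => -[_ [/= Fw _]]; move: wF; rewrite notin_setE.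
  rewrite in_xsectionX//; move: (wF); rewrite in_setE => -[wE wG].
  have -> : xsection S w = [set w' | A (X w ord0 i + X w' ord0 i)] `&` G.
    apply/seteqP; split => w'; rewrite /xsection /= in_setE.
      by move=> [Sw [_ Gw]].
    by move=> [Sw Gw]; split => //; split => //; move: wF; rewrite in_setE.
  have mC : measurable [set w' | A (X w ord0 i + X w' ord0 i)].
    have := measurable_xsection w mSum; congr (measurable _).
    by apply/seteqP; split => w'; rewrite /xsection /= in_setE.
  rewrite probability_setI_ae//.
  rewrite -[RHS](orthogonal_translation (i := i) (y := X w ord0 i) (B := [set x : 'rV[K]_n | A (x ord0 i)])).
  - by congr (P _); apply/seteqP; split => w' /=; rewrite coordE addrC.
  - by rewrite rE lee_fin.
  - exact: coord_mborel.
have S2 : (P \x P)%E S = P (XA `&` X @^-1` E).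
  (* Uniqueness of the product measure permits integration in the other order. *)
  rewrite (product_measure_unique (m' := (P \x^ P)%E))//; last first.
    by move=> *; exact: product_measure2E.
  rewrite -[RHS]mule1 -PG -product_measure2E//; last exact: measurableI.
  apply: eq_integral => w' _ /=.
  have [wG|wG] := boolP (w' \in G); last first.
    rewrite notin_ysectionX//; congr (P _); apply/seteqP; split => // w.
    by rewrite /ysection /= in_setE => -[_ [/= _ Gw]]; move: wG; rewrite notin_setE.
  rewrite in_ysectionX//; move: (wG); rewrite in_setE => wG'.
  have mC : measurable [set w | A (X w ord0 i + X w' ord0 i)].
    have := measurable_ysection w' mSum; congr (measurable _).
    by apply/seteqP; split => w; rewrite /ysection /= in_setE.
  have -> : ysection S w' =
      ([set w | A (X w ord0 i + X w' ord0 i)] `&` X @^-1` E) `&` G.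
    apply/seteqP; split => w; rewrite /ysection /= in_setE.
      by move=> [Sw [[]]].
    by move=> [[]].
  rewrite probability_setI_ae//; last exact: measurableI.
  rewrite -[RHS](orthogonal_translation (i := i) (y := X w' ord0 i)
    (B := [set x : 'rV[K]_n | A (x ord0 i)] `&` E)).
  - by congr (P _); apply/seteqP; split => w /=; rewrite coordE invE.
  - by rewrite rE lee_fin.
  - by apply: mborel_setI => //; exact: coord_mborel.
by rewrite -S2 S1 muleC.
Qed.

(** Coordinates are split off one at a time: the event for the remaining coordinates is unchanged by
    translation along [i], as [orthogonal_factor] requires. *)
Lemma orthogonal_indep : indep absv P (fun i w => X w ord0 i).
Proof.
move=> B mB.
have main (s : seq 'I_n) : uniq s ->
    mborel distn [set x : 'rV[K]_n | forall i, i \in s -> B i (x ord0 i)] /\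
    P [set w | forall i, i \in s -> B i (X w ord0 i)] =
      (\prod_(i <- s) P [set w | B i (X w ord0 i)])%E.
  elim: s => [_|i s IH /= /andP[iNs us]].
    rewrite big_nil (_ : [set x | _] = setT); last by apply/seteqP; split.
    rewrite (_ : [set w | _] = setT); last by apply/seteqP; split.
    split; last exact: probability_setT.
    by rewrite -setC0; apply: mborel_setC; case: (smallest_sigma_algebra setT (mopen distn)).
  have [mE PE] := IH us; rewrite big_cons.
  set E := (X in mborel _ X) in mE.
  have consE (x : 'rV[K]_n) : (forall j, j \in i :: s -> B j (x ord0 j)) <->
      B i (x ord0 i) /\ E x.
    split=> [H|[H1 H2] j]; last by rewrite inE => /predU1P[->//|]; exact: H2.
    by split=> [|j js]; apply: H; rewrite inE ?eqxx// js orbT.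
  split.
    have -> : [set x : 'rV[K]_n | forall j, j \in i :: s -> B j (x ord0 j)] =
        [set x : 'rV[K]_n | B i (x ord0 i)] `&` E.
      by apply/seteqP; split => x /= /consE.
    by apply: mborel_setI => //; exact: coord_mborel.
  have -> : [set w | forall j, j \in i :: s -> B j (X w ord0 j)] =
      [set w | B i (X w ord0 i)] `&` X @^-1` E.
    by apply/seteqP; split => w /= /consE.
  rewrite -PE; apply: orthogonal_factor => // x y; apply/propext; split=> H j js; have := H j js;
    by rewrite !mxE (_ : (j == i) = false) ?mulr0 ?addr0//;
       apply/negP => /eqP ji; move: iNs; rewrite -ji js.
have [_ <-] := main _ (index_enum_uniq _).
congr (P _); apply/seteqP; split => w /= H i _; first exact: H.
by apply: H; exact: mem_index_enum.
Qed.

End GaussianIndep.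

(** * Independent Gaussian coordinates *)

(** A ball of [K^n] is a product of balls of equal radius, so ball probabilities are products over
    the coordinates, and the identities [gaussian_balls] for the single coordinates multiply. *)
Lemma indep_KGaussian (R : realType) (K : fieldType) (absv : K -> R)
    (hK : local_field_absv absv) (n : nat)
    (d : measure_display) (T : measurableType d) (P : probability T R)
    (X : 'I_n -> T -> K) :
  (forall i, KGaussian absv (V := K^o) absv P (X i)) -> indep absv P X ->
  KGaussian absv (maxnorm absv (n := n)) P (fun w => \row_i X i w).
Proof.
move=> gX ind; have habs : nonarch_absv absv by case: hK.
have hn := nonarch_norm_maxnorm habs n.
have hnets : countable_nets (distV (maxnorm absv (n := n))).
  exact: maxnorm_nets n (local_field_nets hK).
have hn1 := nonarch_norm_absv habs.
have dU := distV_ultrametric habs hn.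
have dU1 := distV_ultrametric habs hn1.
have ballE (u : 'rV[K]_n) s : 0 < s ->
    (fun w => \row_i X i w) @^-1` cball (distV (maxnorm absv (n := n))) u s =
    \bigcap_(i in [set: 'I_n]) (X i @^-1` cball (distV (V := K^o) absv) (u ord0 i) s).
  move=> s0; apply/seteqP; split => w; rewrite /cball /distV /=.
    by move/(maxnorm_leP absv _ (ltW s0)) => H i _; have := H i; rewrite !mxE.
  by move=> H; apply/(maxnorm_leP absv _ (ltW s0)) => i; rewrite !mxE; exact: H.
have rX : is_rv (maxnorm absv (n := n)) (fun w => \row_i X i w).
  apply: (measurable_preimage_balls dU hnets) => u s s0; rewrite ballE//.
  apply: fin_bigcap_measurable => // i _; apply: (proj1 (gX i)).
  exact: (cball_mborel dU1).
have PballE (u : 'rV[K]_n) s : 0 < s ->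
    P ((fun w => \row_i X i w) @^-1` cball (distV (maxnorm absv (n := n))) u s) =
    (\prod_(i < n) P (X i @^-1` cball (distV (V := K^o) absv) (u ord0 i) s))%E.
  by move=> s0; rewrite ballE// ind// => i; exact: (cball_mborel dU1).
split=> // d' T' P' Y1 Y2 rY1 rY2 l1 l2 indY a11 a12 a21 a22 ha.
set Z := fun w => _.
have ZE x s : exists u v, [/\ a11 *: u + a12 *: v = x.1, a21 *: u + a22 *: v = x.2 &
    Z @^-1` cball (distV2 (maxnorm absv (n := n))) x s =
    Y1 @^-1` cball (distV (maxnorm absv (n := n))) u s `&`
    Y2 @^-1` cball (distV (maxnorm absv (n := n))) v s].
  (* Every centre in the product space is the image of a pair [(u, v)], so every ball pulls back to
     a rectangle of balls. *)
  have [u [v [e1 e2]]] := orthonormal_pair_surj habs x.1 x.2 ha.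
  exists u, v; split => //.
  by rewrite -(orthonormal_pair_cball habs hn _ _ _ _ _ ha) e1 e2 -surjective_pairing.
have d2U := distV2_ultrametric habs hn.
have n2 := distV2_nets hnets.
have mY1 u s : 0 < s -> measurable (Y1 @^-1` cball (distV (maxnorm absv (n := n))) u s).
  by move=> s0; apply: rY1; exact: (cball_mborel dU).
have mY2 u s : 0 < s -> measurable (Y2 @^-1` cball (distV (maxnorm absv (n := n))) u s).
  by move=> s0; apply: rY2; exact: (cball_mborel dU).
have Yrect u v s : 0 < s ->
    P' (Y1 @^-1` cball (distV (maxnorm absv (n := n))) u s `&`
        Y2 @^-1` cball (distV (maxnorm absv (n := n))) v s) =
    (\prod_(i < n) (P (X i @^-1` cball (distV (V := K^o) absv) (u ord0 i) s) *
                    P (X i @^-1` cball (distV (V := K^o) absv) (v ord0 i) s)))%E.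
  move=> s0; have mB w : mborel (distV (maxnorm absv (n := n)))
      (cball (distV (maxnorm absv (n := n))) w s) by exact: (cball_mborel dU).
  by rewrite indY// l1// l2// !PballE// -big_split.
apply: (probability_eq_balls d2U n2).
- apply: (measurable_preimage_balls d2U n2) => x s s0.
  by have [u [v [_ _ ->]]] := ZE x s; apply: measurableI; [exact: mY1|exact: mY2].
- apply: (measurable_preimage_balls d2U n2) => -[x y] s s0; rewrite cball_distV2.
  exact: (measurableI _ _ (mY1 x s s0) (mY2 y s s0)).
move=> [x y] s s0; have [u [v [/= e1 e2 ->]]] := ZE (x, y) s.
rewrite cball_distV2 [in RHS](_ : _ @^-1` _ =
  Y1 @^-1` cball (distV (maxnorm absv (n := n))) x s `&`
  Y2 @^-1` cball (distV (maxnorm absv (n := n))) y s)// !Yrect//.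
apply: eq_bigr => i _; rewrite -e1 -e2 !mxE.
by rewrite -(gaussian_balls habs hn1 (gX i) _ _ s0 ha).
Qed.

Unset Implicit Arguments.
Theorem theorem4p8 (R : realType) (K : fieldType) (absv : K -> R)
  (hK : local_field_absv absv) (n : nat)
  (d : measure_display) (T : measurableType d) (P : probability T R) :
  (forall X : T -> 'rV[K]_n,
     KGaussian absv (maxnorm absv (n:=n)) P X ->
     (Linf_orthogonal absv P (fun i w => X w ord0 i) <->
      indep absv P (fun i w => X w ord0 i))) /\
  (forall X : 'I_n -> T -> K,
     (forall i, KGaussian absv (V := K^o) absv P (X i)) ->
     indep absv P X ->
     KGaussian absv (maxnorm absv (n:=n)) P (fun w => \row_i X i w)).
Proof.
split=> X gX; last exact: indep_KGaussian.
by split; [exact: orthogonal_indep|exact: indep_Linf_orthogonal].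
Qed.
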